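(* There is a countable sequential space which is not selectively separable.
   Context: A topological space $X$ is selectively separable if for every sequence $(D_n:n\in\omega)$ of dense subspaces of $X$ one can pick finite sets $F_n\subset D_n$ so that $\bigcup_{n\in\omega}F_n$ is dense in $X$. $X$ is sequential if whenever $A\subset X$ is not closed there are a point $p\in\overline A\setminus A$ and a sequence of points of $A$ converging to $p$. *)

(* Defs.v *)
From mathcomp Require Import all_boot all_classical topology.
Set Implicit Arguments.
Unset Strict Implicit.
Unset Printing Implicit Defensive.
Local Open Scope classical_set_scope.

Definition selectively_separable (X : topologicalType) : Prop :=
  forall D : nat -> set X, (forall n, dense (D n)) ->
  exists F : nat -> set X,
    (forall n, finite_set (F n) /\ F n `<=` D n) /\
    dense (\bigcup_n F n).

Definition sequential (X : topologicalType) : Prop :=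
  forall A : set X, ~ closed A ->
  exists p : X, (closure A `\` A) p /\
    exists u : nat -> X, (forall n, A (u n)) /\ u @ \oo --> p.

(* Main.v *)
From HB Require Import structures.
Require Import Defs.
From mathcomp Require Import all_boot all_classical topology.
Local Open Scope classical_set_scope.

(** The witness is the Arkhangel'skii-Franklin space: the tree of finite
    sequences of naturals, where a set is open iff with each node it contains
    all but finitely many of its children. The set [D n] of the nodes of level
    at least [n] is dense. If [F n] is a finite subset of [D n], the union of
    the [F n] meets every level in a finite set, so it is a proper closed set
    and cannot be dense. *)

(* The children of [s] are the sequences [k :: s]. *)
Definition tree_open (U : set (seq nat)) : Prop :=
  forall s, U s -> exists N, forall k, N <= k -> U (k :: s).

Lemma tree_openT : tree_open setT.
Proof. by move=> s _; exists 0. Qed.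

Lemma tree_openI (U V : set (seq nat)) :
  tree_open U -> tree_open V -> tree_open (U `&` V).
Proof.
move=> oU oV s [/oU[M hM] /oV[N hN]]; exists (maxn M N) => k.
by rewrite geq_max => /andP[Mk Nk]; split; [exact: hM | exact: hN].
Qed.

Lemma tree_open_bigU (I : Type) (f : I -> set (seq nat)) :
  (forall i, tree_open (f i)) -> tree_open (\bigcup_i f i).
Proof.
by move=> of_ s [i _ /of_[N hN]]; exists N => k Nk; exists i => //; exact: hN.
Qed.

Definition tree : Type := seq nat.

HB.instance Definition _ := Choice.on tree.
HB.instance Definition _ :=
  isOpenTopological.Build tree tree_openT tree_openI tree_open_bigU.

Lemma tree_openE : (open : set (set tree)) = tree_open.
Proof. by []. Qed.

Lemma tree_closedP (A : set tree) :
  (forall s, ~ A s -> exists N, forall k, N <= k -> ~ A (k :: s)) -> closed A.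
Proof. by move=> h; rewrite -openC tree_openE => s; exact: h. Qed.

Lemma tree_countable : countable [set: tree].
Proof. exact: (@countableP (seq nat)). Qed.

(** A neighbourhood of [s] contains every child with a large enough label, and [n <= g n] pushes the
    labels past any bound. *)
Lemma tree_cvg_children (s : tree) (g : nat -> nat) :
  (forall n, n <= g n) -> ((fun n => g n :: s) : nat -> tree) @ \oo --> s.
Proof.
move=> gge U; rewrite nbhsE => -[V [oV Vs] VU].
move: oV; rewrite tree_openE => /(_ _ Vs)[N hN].
by exists N => // n /= Nn; apply/VU/hN/(leq_trans Nn).
Qed.

(** If each node outside [A] had only finitely many children in [A], then [A] would be closed. So
    some [s] outside [A] has infinitely many, and these supply the sequence. *)
Lemma tree_sequential : sequential tree.
Proof.
move=> A nclA.
have [s [As sA]] :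
    exists s, ~ A s /\ forall N, exists k, N <= k /\ A (k :: s).
  apply: contrapT => h; apply: nclA; apply: tree_closedP => s As.
  apply: contrapT => h'; apply: h; exists s; split => // N.
  apply: contrapT => hN; apply: h'; exists N => k Nk Ak.
  by apply: hN; exists k.
have [g hg] := choice sA.
have gs : ((fun n => g n :: s) : nat -> tree) @ \oo --> s.
  by apply: tree_cvg_children => n; case: (hg n).
exists s; split; last by exists (fun n => g n :: s); split=> // n; case: (hg n).
split=> // U /gs[N _ hN]; exists (g N :: s); split; first by case: (hg N).
by apply: hN => /=.
Qed.

(** From any node of an open set one can climb to a child inside the set, hence to any level. *)
Lemma dense_levels_ge (n : nat) : dense ([set s | n <= size s] : set tree).
Proof.
move=> U [s Us]; rewrite tree_openE => oU; elim: n => [|n [t [Ut nt]]].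
  by exists s.
by have [N hN] := oU _ Ut; exists (N :: t); split; [exact: hN | exact: nt].
Qed.

Lemma finite_levels_children_bound (A : set tree) :
    (forall n, finite_set (A `&` [set t | size t = n])) ->
  forall s : tree, exists N, forall k, N <= k -> ~ A (k :: s).
Proof.
move=> fA s; have /finite_seqP[r rE] := fA (size s).+1.
(* All children of [s] lie in one level, where [r] lists [A]; the head of a child is its label. *)
exists (\max_(t <- r) head 0 t).+1 => k + Ak; apply/negP; rewrite -leqNgt.
have : (A `&` [set t | size t = (size s).+1]) (k :: s) by [].
by rewrite rE /= => kr; apply: (leq_bigmax_seq (k :: s)).
Qed.

Lemma tree_not_selectively_separable : ~ selectively_separable tree.
Proof.
move=> /(_ _ dense_levels_ge)[F [hF dF]].
have fA n : finite_set ((\bigcup_i F i) `&` [set t | size t = n]).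
  (* Nodes of [F i] have level at least [i], so only [F 0], ..., [F n] reach level [n]. *)
  apply: (@sub_finite_set _ _ (\bigcup_(i in `I_n.+1) F i)).
    move=> t [[i _ Fit] /= tn]; exists i => //=.
    by rewrite ltnS -tn; case: (hF i) => _; exact.
  by apply: bigcup_finite => // i _; case: (hF i).
have bA := finite_levels_children_bound _ fA.
(* The root may lie in the union, so a point outside is sought among its children. *)
have [N hN] := bA [::].
have [||s []//] := dF (~` \bigcup_i F i).
  by exists [:: N]; exact: hN.
by rewrite openC; apply: tree_closedP => s _; exact: bA.
Qed.

Theorem mainTheorem2 :
  exists X : topologicalType,
    countable [set: X] /\ sequential X /\ ~ selectively_separable X.
Proof.
exists tree; split; first exact: tree_countable.
by split; [exact: tree_sequential | exact: tree_not_selectively_separable].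
Qed.
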